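(* Let $C:f(x,y)=0$ be any reduced invariant curve of a singular foliation $\mathcal{F}$ at $(\mathbb{C}^2,p)$. Then $$GSV_p(\mathcal{F},C)=i_p(\mathcal{P}^{\mathcal{F}},C)-i_p(\mathcal{P}^{df},C).$$
   Context: **Foliations.** A singular foliation $\mathcal F$ at $(\mathbb C^2,p)$ is given, in coordinates $(x,y)$ centered at $p$, by a (holomorphic or formal) 1-form $\omega=P\,dx+Q\,dy$ with $P,Q\in\mathbb C[[x,y]]$ relatively prime and vanishing at $p$. $i_p(g,h)=\dim_{\mathbb C}\mathbb C[[x,y]]/(g,h)$ is the intersection number of curves $g=0$, $h=0$. A curve $f=0$, $f\in\mathbb C[[x,y]]$, is $\mathcal F$-invariant if $\omega\wedge df=fh\,dx\wedge dy$ for some $h\in\mathbb C[[x,y]]$ (its branches may be purely formal). The generic polar $\mathcal P^{\mathcal F}$ is the curve $aP+bQ=0$ for generic $(a:b)\in\mathbb P^1(\mathbb C)$; $\mathcal P^{df}$ is the curve $a\,\partial_xf+b\,\partial_yf=0$ for generic $(a:b)$. **GSV-index.** For a reduced $\mathcal F$-invariant curve $C:f=0$ there are $g,h\in\mathbb C[[x,y]]$, each relatively prime to $f$, and a 1-form $\eta$ with $g\omega=h\,df+f\eta$. If $C$ is irreducible, $GSV_p(\mathcal F,C)=i_p(f,h)-i_p(f,g)$. In general, $GSV_p$ is determined by the adjunction formula $GSV_p(\mathcal F,C_1\cup C_2)=GSV_p(\mathcal F,C_1)+GSV_p(\mathcal F,C_2)-2i_p(C_1,C_2)$ for invariant curves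 without common components. (For analytic $C$ this equals $\frac1{2\pi i}\int_{\partial C}\frac gh d\left(\frac hg\right)$.) *)

(* Defs.v *)
From HB Require Import structures.
From mathcomp Require Import all_boot all_order all_algebra.
From mathcomp Require Import boolp classical_sets functions reals complex.

Set Implicit Arguments.
Unset Strict Implicit.
Unset Printing Implicit Defensive.

Import GRing.Theory.
Local Open Scope ring_scope.

(* A record rather than a plain function type: nat -> A already carries the
   pointwise product. *)
Record fps (A : Type) := FPS { fps_coef :> nat -> A }.

HB.instance Definition _ A := [isNew for @fps_coef A].
HB.instance Definition _ (A : choiceType) := [Choice of fps A by <:].

Section FpsRing.
Variable A : comNzRingType.
Implicit Types f g h : fps A.

Lemma fpsP f g : (forall n, f n = g n) <-> f = g.
Proof. by split=> [e|->//]; apply: val_inj; apply/funext. Qed.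

Definition fps0 : fps A := FPS (fun=> 0).
Definition fps1 : fps A := FPS (fun n => (n == 0)%:R).
Definition fps_opp f : fps A := FPS (fun n => - f n).
Definition fps_add f g : fps A := FPS (fun n => f n + g n).
Definition fps_mul f g : fps A :=
  FPS (fun n => \sum_(k < n.+1) f k * g (n - k)%N).

Lemma fps_addA : associative fps_add.
Proof. by move=> f g h; apply/fpsP => n /=; rewrite addrA. Qed.
Lemma fps_addC : commutative fps_add.
Proof. by move=> f g; apply/fpsP => n /=; rewrite addrC. Qed.
Lemma fps_add0 : left_id fps0 fps_add.
Proof. by move=> f; apply/fpsP => n /=; rewrite add0r. Qed.
Lemma fps_addN : left_inverse fps0 fps_opp fps_add.
Proof. by move=> f; apply/fpsP => n /=; rewrite addNr. Qed.

HB.instance Definition _ :=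
  GRing.isZmodule.Build (fps A) fps_addA fps_addC fps_add0 fps_addN.

Definition fps_trunc N f : {poly A} := \poly_(i < N) f i.

Lemma fps_mul_trunc N f g n : (n < N)%N ->
  fps_mul f g n = (fps_trunc N f * fps_trunc N g)`_n.
Proof.
move=> nN; rewrite coefM /=; apply: eq_bigr => k _.
have kN : (k < N)%N by apply: leq_trans nN; apply: ltn_ord.
by rewrite !coef_poly kN (leq_ltn_trans (leq_subr _ _) nN).
Qed.

Lemma fps_mulC : commutative fps_mul.
Proof.
by move=> f g; apply/fpsP => n; rewrite !(@fps_mul_trunc n.+1) // mulrC.
Qed.

Lemma fps_mulA : associative fps_mul.
Proof.
move=> f g h; apply/fpsP => n.
have trunc_mul u v k : (k < n.+1)%N ->
    (fps_trunc n.+1 (fps_mul u v))`_k = (fps_trunc n.+1 u * fps_trunc n.+1 v)`_k.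
  by move=> kn; rewrite coef_poly kn (fps_mul_trunc _ _ kn).
rewrite !(@fps_mul_trunc n.+1) //.
transitivity (fps_trunc n.+1 f * (fps_trunc n.+1 g * fps_trunc n.+1 h))`_n.
  rewrite !(coefM (fps_trunc n.+1 f)); apply: eq_bigr => k _.
  by rewrite trunc_mul // ltnS leq_subr.
rewrite mulrA ![in LHS]coefM [in RHS]coefM; apply: eq_bigr => k _.
by rewrite trunc_mul // coefM.
Qed.

Lemma fps_mul1 : left_id fps1 fps_mul.
Proof.
move=> f; apply/fpsP => n /=; rewrite big_ord_recl /= mul1r subn0.
by rewrite big1 ?addr0 // => k _; rewrite mul0r.
Qed.

Lemma fps_mulDl : left_distributive fps_mul fps_add.
Proof.
move=> f g h; apply/fpsP => n /=; rewrite -big_split /=.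
by apply: eq_bigr => k _; rewrite mulrDl.
Qed.

Lemma fps_one_neq0 : fps1 != (0 : fps A).
Proof.
by apply/eqP => /fpsP /(_ 0%N) /= /eqP; rewrite (oner_eq0 A).
Qed.

HB.instance Definition _ := GRing.Zmodule_isComNzRing.Build (fps A)
  fps_mulA fps_mulC fps_mul1 fps_mulDl fps_one_neq0.

Definition fps_unit : pred (fps A) := fun f => `[< exists g, g * f = 1 >].

Definition fps_inv f : fps A :=
  if pselect (exists g, g * f = 1) is left e then projT1 (cid e) else f.

Lemma fps_mulV : {in fps_unit, left_inverse 1 fps_inv *%R}.
Proof.
move=> f /asboolP e; rewrite /fps_inv; case: pselect => // e'.
by case: (cid e').
Qed.

Lemma fps_unitP f g : g * f = 1 -> fps_unit f.
Proof. by move=> e; apply/asboolP; exists g. Qed.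

Lemma fps_inv_out : {in [predC fps_unit], fps_inv =1 id}.
Proof.
by move=> f /asboolP nu; rewrite /fps_inv; case: pselect.
Qed.

HB.instance Definition _ := GRing.ComNzRing_hasMulInverse.Build (fps A)
  fps_mulV fps_unitP fps_inv_out.

Lemma coef_fpsM f g n : (f * g) n = \sum_(k < n.+1) f k * g (n - k)%N.
Proof. by []. Qed.

Lemma coef_fps_sum I (r : seq I) (P : pred I) (F : I -> fps A) n :
  (\sum_(i <- r | P i) F i) n = \sum_(i <- r | P i) F i n.
Proof. exact: (big_morph (fun f : fps A => f n)). Qed.

Definition fpsC (a : A) : fps A := FPS (fun n => if n is 0 then a else 0).

End FpsRing.

Section Divisibility.
Variable A : comUnitRingType.
Implicit Types a b d : A.

Definition rdvd d a := exists c, a = c * d.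

Definition rcoprime a b :=
  forall d, rdvd d a -> rdvd d b -> d \is a GRing.unit.

Definition rirreducible a :=
  [/\ a != 0, a \isn't a GRing.unit &
      forall b c, a = b * c -> b \is a GRing.unit \/ c \is a GRing.unit].

Definition rsquarefree a :=
  a != 0 /\ forall d, rdvd (d * d) a -> d \is a GRing.unit.

End Divisibility.

(* C[[x,y]] as C[[y]][[x]]: f i j is the coefficient of x^i y^j. *)
Notation cseries R := (fps (fps R[i])).

Section Foliation.
Variable R : realType.
Implicit Types (a b c : R[i]) (f g h : cseries R) (n : nat).

Lemma coef_cseriesM f g i j :
  (f * g) i j =
  \sum_(k < i.+1) \sum_(l < j.+1) f k l * g (i - k)%N (j - l)%N.
Proof. by rewrite coef_fpsM coef_fps_sum. Qed.

Definition cseriesC c : cseries R := fpsC (fpsC c).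

Definition pdx f : cseries R := FPS (fun i => FPS (fun j => f i.+1 j *+ i.+1)).
Definition pdy f : cseries R := FPS (fun i => FPS (fun j => f i j.+1 *+ j.+1)).

(* (P, Q) stands for the 1-form P dx + Q dy. *)
Definition oneform : Type := (cseries R * cseries R)%type.
Implicit Types w eta : oneform.

Definition dform f : oneform := (pdx f, pdy f).

(* The coefficient of dx /\ dy. *)
Definition wedge w eta : cseries R := w.1 * eta.2 - w.2 * eta.1.

Definition singular_foliation w :=
  [/\ rcoprime w.1 w.2, w.1 0%N 0%N = 0 & w.2 0%N 0%N = 0].

Definition reduced_curve f := f 0%N 0%N = 0 /\ rsquarefree f.

Definition invariant_curve w f := exists h, wedge w (dform f) = f * h.

Definition in_ideal2 g h (u : cseries R) := exists r s, u = r * g + s * h.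

(* int_number g h n : the C-vector space C[[x,y]]/(g,h) is finite dimensional
   of dimension n; e lifts a basis of it. *)
Definition int_number g h n :=
  exists e : 'I_n -> cseries R, forall u, exists! c : 'rV[R[i]]_n,
    in_ideal2 g h (u - \sum_i cseriesC (c 0 i) * e i).

(* "For generic (a : b) in P^1(C)": outside finitely many points, given by
   homogeneous coordinates. *)
Definition generic_P1 (Phi : R[i] -> R[i] -> Prop) :=
  exists2 s : seq (R[i] * R[i]), (0, 0) \notin s &
    forall a b, (a, b) != (0, 0) ->
      (forall q, q \in s -> a * q.2 != b * q.1) -> Phi a b.

Definition polar w a b : cseries R := cseriesC a * w.1 + cseriesC b * w.2.

(* The intersection number at p of the generic polar of w with f = 0. *)
Definition polar_int_number w f n :=
  generic_P1 (fun a b => int_number (polar w a b) f n).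

(* g w = h df + f eta *)
Definition gsv_decomp w f g h eta :=
  g * w.1 = h * pdx f + f * eta.1 /\ g * w.2 = h * pdy f + f * eta.2.

(* is_GSV w f z : z is a value of GSV_p(w, f = 0), computed through some
   splitting of f and some decompositions of g w along its factors. *)
Inductive is_GSV w : cseries R -> int -> Prop :=
| GSV_irreducible f g h eta m n :
    rirreducible f -> invariant_curve w f ->
    rcoprime g f -> rcoprime h f -> gsv_decomp w f g h eta ->
    int_number f h m -> int_number f g n ->
    is_GSV w f (m%:Z - n%:Z)
| GSV_adjunction f1 f2 z1 z2 n :
    invariant_curve w f1 -> invariant_curve w f2 -> rcoprime f1 f2 ->
    is_GSV w f1 z1 -> is_GSV w f2 z2 -> int_number f1 f2 n ->
    is_GSV w (f1 * f2) (z1 + z2 - 2 * n%:Z).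

End Foliation.

(* Main.v *)
Require Import Defs.
From HB Require Import structures.
From mathcomp Require Import all_boot all_order all_algebra.
From mathcomp Require Import boolp reals complex.
From mathcomp Require Import ring zify.

Set Implicit Arguments.
Unset Strict Implicit.
Unset Printing Implicit Defensive.

Import GRing.Theory Num.Theory.
Local Open Scope ring_scope.

(** Let w = P dx + Q dy, and let F_(a:b) = a P + b Q and D_(a:b) = a f_x + b f_y be the members of the
   two pencils of polars. When f is irreducible, a decomposition
   g w = h df + f eta gives g F_(a:b) = h D_(a:b) modulo f for every (a : b),
   so additivity of the intersection number yields
   i(f, g) + i(f, F) = i(f, h) + i(f, D), which is the theorem for f
   ([is_GSV_polar]). Such a decomposition is read off from w /\ df = f k:
   one may take g = f_y, h = Q, or g = f_x, h = P ([gsv_decomp_exists]).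
   For a product f1 f2 of coprime factors, i(F, f) is additive, while
   D(f1 f2) = f2 D(f1) modulo f1 and symmetrically, so that the polar of
   d(f1 f2) meets f1 f2 in i(f1, f2) points more on each factor: this is the
   correction - 2 i(f1, f2) of the adjunction formula
   ([polar_coprime_dformM]). Induction over the splittings of f concludes; it
   also produces the two generic intersection numbers.

   The work lies in the arithmetic of C[[x,y]] that this takes for granted.
   Seeing C[[x,y]] as C[[y]][[x]], Weierstrass division is a recursion on
   the coefficients of powers of x ([weierstrass_division]). Choosing an
   element of least order in y, it gives, for f and g coprime, a power of x
   in the ideal (f, g) ([rcoprime_bezoutX]); with its mirror image this is
   enough for Euclid's lemma ([rdvd_coprime_mul]), hence for the additivity
   of intersection numbers ([int_numberM]).

   For f with f(0, y) of order d, division by f makes C[[x,y]]/(f) a free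
   C[[x]]-module of rank d, and i(u, f) is the order in x of the determinant
   of the multiplication by u ([int_number_mulmat], [codim_row_space]). For
   u = P + t Q this determinant is a polynomial in t with coefficients in
   C[[x]], so its order is the same for all but finitely many t
   ([pencil_order]): the generic polar has a well defined intersection number
   with f. An irreducible f for which this does not apply is x up to a unit,
   and exchanging x and y brings it back to that case. *)

(** * Formal power series over a ring *)

Section FpsCoefficients.
Variable A : comNzRingType.
Implicit Types f g : fps A.

Lemma coef_fpsD f g n : (f + g) n = f n + g n. Proof. by []. Qed.
Lemma coef_fpsB f g n : (f - g) n = f n - g n. Proof. by []. Qed.
Lemma coef_fps0 n : (0 : fps A) n = 0. Proof. by []. Qed.
Lemma coef_fpsMn f m n : (f *+ m) n = f n *+ m.
Proof. by elim: m => // m IH; rewrite !mulrS coef_fpsD IH. Qed.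

Lemma coef_fpsCM a f n : (fpsC a * f) n = a * f n.
Proof.
rewrite coef_fpsM big_ord_recl subn0 big1 ?addr0 // => k _.
by rewrite /= mul0r.
Qed.

Lemma fpsC_zmod_morphism : zmod_morphism (@fpsC A).
Proof. by move=> a b; apply/fpsP => -[|n] /=; rewrite ?subr0. Qed.
Lemma fpsC_monoid_morphism : monoid_morphism (@fpsC A).
Proof.
split; first by apply/fpsP => -[].
by move=> a b; apply/fpsP => n; rewrite coef_fpsCM; case: n => //= n; rewrite mulr0.
Qed.
HB.instance Definition _ :=
  GRing.isZmodMorphism.Build A (fps A) (@fpsC A) fpsC_zmod_morphism.
HB.instance Definition _ :=
  GRing.isMonoidMorphism.Build A (fps A) (@fpsC A) fpsC_monoid_morphism.

Definition fps_ev0 f : A := f 0%N.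

Lemma fps_ev0_zmod_morphism : zmod_morphism fps_ev0.
Proof. by []. Qed.
Lemma fps_ev0_monoid_morphism : monoid_morphism fps_ev0.
Proof.
by split=> // f g; rewrite /fps_ev0 coef_fpsM big_ord1.
Qed.
HB.instance Definition _ :=
  GRing.isZmodMorphism.Build (fps A) A fps_ev0 fps_ev0_zmod_morphism.
HB.instance Definition _ :=
  GRing.isMonoidMorphism.Build (fps A) A fps_ev0 fps_ev0_monoid_morphism.

Definition fpsX : fps A := FPS (fun n => (n == 1%N)%:R).

Lemma coef_fpsXM f n : (fpsX * f) n = if n is m.+1 then f m else 0.
Proof.
rewrite coef_fpsM; case: n => [|m]; first by rewrite big_ord1 /= mul0r.
rewrite big_ord_recl /= mul0r add0r big_ord_recl /= mul1r subSS subn0.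
by rewrite big1 ?addr0 // => k _; rewrite mul0r.
Qed.

Lemma coef_fpsXnM m f n :
  (fpsX ^+ m * f) n = if (n < m)%N then 0 else f (n - m)%N.
Proof.
elim: m n => [|m IH] n; first by rewrite expr0 mul1r subn0.
by rewrite exprS -mulrA coef_fpsXM; case: n.
Qed.

Lemma fps_cutE m f : (forall k, (k < m)%N -> f k = 0) ->
  f = fpsX ^+ m * FPS (fun n => f (n + m)%N).
Proof.
move=> f0; apply/fpsP => n; rewrite coef_fpsXnM /=.
by case: ltnP => [/f0|/subnK->].
Qed.

Lemma coef_fpsM_low f g m n :
    (forall k, (k < m)%N -> f k = 0) -> (forall k, (k < n)%N -> g k = 0) ->
  (forall k, (k < m + n)%N -> (f * g) k = 0) /\ (f * g) (m + n)%N = f m * g n.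
Proof.
move=> /fps_cutE -> /fps_cutE ->; rewrite mulrACA -exprD.
split=> [k kmn|]; first by rewrite coef_fpsXnM kmn.
by rewrite !coef_fpsXnM !ltnn !subnn coef_fpsM big_ord1.
Qed.

(** The quotient is built one coefficient at a time: the n-th coefficient of
    q is obtained by dividing, by the constant coefficient of f, what the
    previous ones leave of the n-th coefficient of g. *)
Lemma fps_division f (P : A -> Prop) :
    (forall a, exists q r, a = q * f 0%N + r /\ P r) ->
  forall g, exists q r, g = q * f + r /\ forall n, P (r n).
Proof.
move=> divf g.
have [Q QP] := choice divf; have [Rr RrP] := choice QP.
pose residue m (s : seq A) := g m - \sum_(k < m) s`_k * f (m - k)%N.
pose qs := fix qs n : seq A :=
  if n is m.+1 then rcons (qs m) (Q (residue m (qs m))) else [::].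
have size_qs n : size (qs n) = n by elim: n => //= n IH; rewrite size_rcons IH.
pose q := FPS (fun k => (qs k.+1)`_k).
have nth_qs n k : (k < n)%N -> (qs n)`_k = q k.
  elim: n => // n IH; rewrite ltnS leq_eqVlt => /orP[/eqP-> //|kn].
  by rewrite /= nth_rcons size_qs kn IH.
exists q, (g - q * f); split=> [|n]; first by rewrite addrC subrK.
have q_n : q n = Q (residue n (qs n)) by rewrite /= nth_rcons size_qs ltnn eqxx.
have [e Pr] := RrP (residue n (qs n)).
suff -> : (g - q * f) n = Rr (residue n (qs n)) by [].
rewrite coef_fpsB coef_fpsM big_ord_recr subnn q_n opprD addrA.
apply/eqP; rewrite subr_eq [X in _ == X]addrC.
rewrite -e /residue; apply/eqP; congr (_ - _); apply: eq_bigr => k _.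
by rewrite nth_qs.
Qed.

End FpsCoefficients.

(** Division of 1 by f with zero remainder. *)
Lemma fps_unitE (A : comUnitRingType) (f : fps A) :
  (f \is a GRing.unit) = (f 0%N \is a GRing.unit).
Proof.
apply/idP/idP => [uf|uf0]; first exact: (rmorph_unit (@fps_ev0 A)).
have [a|q [r [e r0]]] := @fps_division A f (fun r => r = 0) _ 1.
  by exists (a / f 0%N), 0; rewrite divrK // addr0.
apply/unitrPr; exists q; rewrite mulrC e.
suff -> : r = 0 by rewrite addr0.
by apply/fpsP.
Qed.

(** * Order and leading coefficient *)

Section FpsDomain.
Variable A : idomainType.
Implicit Types f g : fps A.

Lemma fps_neq0P f : f != 0 -> exists n, f n != 0.
Proof.
move=> f0; apply: contrapT => no; case/eqP: f0; apply/fpsP => n.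
by apply/eqP/negPn/negP => fn; apply: no; exists n.
Qed.

Lemma fps_orderP f : f != 0 ->
  exists n, f n != 0 /\ forall k, (k < n)%N -> f k = 0.
Proof.
move=> /fps_neq0P ex; case: (ex_minnP ex) => n fn lo; exists n; split=> // k.
by apply: contraTeq => /lo; rewrite -leqNgt.
Qed.

Definition ord f : nat := if pselect (f != 0) is left e
  then projT1 (cid (fps_orderP e)) else 0%N.

Lemma coef_ord f : f != 0 -> f (ord f) != 0.
Proof.
by rewrite /ord; case: pselect => // e _; case: (cid _) => n [].
Qed.

Lemma coef_lt_ord f k : (k < ord f)%N -> f k = 0.
Proof.
rewrite /ord; case: pselect => // e; case: (cid _) => n [_] /= fk; exact: fk.
Qed.

Lemma ord_le f n : f n != 0 -> (ord f <= n)%N.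
Proof. by move=> fn; rewrite leqNgt; apply: contraNN fn => /coef_lt_ord->. Qed.

Lemma ord_eq f n : f n != 0 -> (forall k, (k < n)%N -> f k = 0) -> ord f = n.
Proof.
move=> fn lo; apply/eqP; rewrite eqn_leq ord_le //= leqNgt.
apply/negP => /lo /eqP; apply/negP; apply: coef_ord.
by apply: contraNneq fn => ->.
Qed.

Definition lead f := f (ord f).

Lemma lead_neq0 f : f != 0 -> lead f != 0. Proof. exact: coef_ord. Qed.

Lemma coef_fpsM_ord f g :
  (forall k, (k < ord f + ord g)%N -> (f * g) k = 0) /\
  (f * g) (ord f + ord g)%N = lead f * lead g.
Proof. by apply: coef_fpsM_low => k; apply: coef_lt_ord. Qed.

Lemma fps_integral : GRing.integral_domain_axiom (fps A).
Proof.
move=> f g fg0; apply/norP => -[/lead_neq0 f0 /lead_neq0 g0].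
have /esym/eqP := (coef_fpsM_ord f g).2.
by rewrite fg0 coef_fps0 mulf_eq0 (negPf f0) (negPf g0).
Qed.
HB.instance Definition _ :=
  GRing.ComUnitRing_isIntegral.Build (fps A) fps_integral.

Lemma ordM f g : f != 0 -> g != 0 -> ord (f * g) = (ord f + ord g)%N.
Proof.
move=> f0 g0; have [lo eq] := coef_fpsM_ord f g; apply: ord_eq => //.
by rewrite eq mulf_neq0 // lead_neq0.
Qed.

Lemma leadM f g : f != 0 -> g != 0 -> lead (f * g) = lead f * lead g.
Proof. by move=> f0 g0; rewrite {1}/lead ordM // (coef_fpsM_ord f g).2. Qed.

Lemma fpsX_neq0 : fpsX A != 0.
Proof. by apply/eqP => /fpsP /(_ 1%N) /eqP; rewrite oner_eq0. Qed.

Lemma fps_factorX f : f != 0 -> exists m g, f = fpsX A ^+ m * g /\ g 0%N != 0.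
Proof.
move=> f0; exists (ord f), (FPS (fun n => f (n + ord f)%N)).
by split; [apply: fps_cutE => k; apply: coef_lt_ord | apply: lead_neq0].
Qed.

End FpsDomain.

(** * Weierstrass division *)

Section FieldSeries.
Variable K : fieldType.

Lemma fps_division_field (f a : fps K) d : ord f = d -> f != 0 ->
  exists q r, a = q * f + r /\ forall j, (d <= j)%N -> r j = 0.
Proof.
move=> ord_f f0.
have fE : f = fpsX K ^+ d * FPS (fun n => f (n + d)%N).
  by apply: fps_cutE => k; rewrite -ord_f; apply: coef_lt_ord.
set u := FPS _ in fE.
have uu : u \is a GRing.unit.
  by rewrite fps_unitE unitfE /= add0n -ord_f coef_ord.
pose r := FPS (fun j => if (j < d)%N then a j else 0).
have rE : a - r = fpsX K ^+ d * FPS (fun n => (a - r) (n + d)%N).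
  by apply: fps_cutE => k kd; rewrite coef_fpsB /= kd subrr.
exists (FPS (fun n => (a - r) (n + d)%N) / u), r; split=> [|j dj]; last first.
  by rewrite /= ltnNge dj.
by rewrite {1}fE mulrCA divrK // -rE subrK.
Qed.

End FieldSeries.

Section Weierstrass.
Variable K : fieldType.
Implicit Types f g : fps (fps K).

(** Division by f in K[[y]][[x]] reduces, coefficient by coefficient, to
   division by f(0, y) in K[[y]], where remainders are polynomials of degree
   less than the order of f(0, y). *)
Lemma weierstrass_division f g : f 0%N != 0 ->
  exists q r, g = q * f + r /\ forall i j, (ord (f 0%N) <= j)%N -> r i j = 0.
Proof.
move=> f0; have [a|q [r [e rP]]] := @fps_division _ f
    (fun r => forall j, (ord (f 0%N) <= j)%N -> r j = 0) _ g.
  exact: fps_division_field.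
by exists q, r.
Qed.

(** The lowest coefficient in x of q f is a nonzero multiple of f(0, y), so
   it cannot be a polynomial in y of smaller degree. *)
Lemma weierstrass_uniq f q : f 0%N != 0 ->
  (forall i j, (ord (f 0%N) <= j)%N -> (q * f) i j = 0) -> q = 0.
Proof.
move=> f0 low; apply: contrapT => /eqP q0.
have fn0 : f != 0 by apply: contraNneq f0 => ->.
have of0 : ord f = 0%N by apply/eqP; rewrite -leqn0 ord_le.
have := (coef_fpsM_ord q f).2; rewrite of0 addn0 /lead of0 => e.
have /negP[] := coef_ord (mulf_neq0 (lead_neq0 q0) f0).
by rewrite ordM ?lead_neq0 // -e low // leq_addl.
Qed.

End Weierstrass.

(** * Derivation and exchange of the variables *)

Section Derivation.
Variable A : comNzRingType.
Implicit Types f g : fps A.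

Definition fps_deriv f : fps A := FPS (fun n => f n.+1 *+ n.+1).

Lemma fps_derivM f g : fps_deriv (f * g) = fps_deriv f * g + f * fps_deriv g.
Proof.
apply/fpsP => n.
have -> : fps_deriv (f * g) n = (fps_trunc n.+2 f * fps_trunc n.+2 g)^`()`_n.
  by rewrite coef_deriv -fps_mul_trunc.
rewrite derivM coefD.
have T h k : (k < n.+1)%N -> (fps_trunc n.+2 h)^`()`_k = fps_deriv h k.
  by move=> kn; rewrite coef_deriv coef_poly ltnS kn.
rewrite coef_fpsD !coefM !coef_fpsM; congr (_ + _); apply: eq_bigr => k _.
  by rewrite T // coef_poly ltnS leqW // leq_subr.
by rewrite T ?ltnS ?leq_subr // coef_poly leqW.
Qed.

End Derivation.

Section Swap.
Variable A : comNzRingType.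
Implicit Types f g : fps (fps A).

Definition swap f : fps (fps A) := FPS (fun i => FPS (fun j => f j i)).

Lemma swapK : involutive swap.
Proof. by move=> f; apply/fpsP => i; apply/fpsP. Qed.

Lemma swap_zmod_morphism : zmod_morphism swap.
Proof. by move=> f g; apply/fpsP => i; apply/fpsP. Qed.

Lemma swap_monoid_morphism : monoid_morphism swap.
Proof.
split; first by apply/fpsP => -[|i]; apply/fpsP => -[|j].
move=> f g; apply/fpsP => i; apply/fpsP => j.
have coefM2 (u v : fps (fps A)) k l : (u * v) k l =
    \sum_(m < k.+1) \sum_(n < l.+1) u m n * v (k - m)%N (l - n)%N.
  by rewrite coef_fpsM coef_fps_sum.
by rewrite [RHS]coefM2 exchange_big -coefM2.
Qed.

HB.instance Definition _ :=
  GRing.isZmodMorphism.Build _ _ swap swap_zmod_morphism.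
HB.instance Definition _ :=
  GRing.isMonoidMorphism.Build _ _ swap swap_monoid_morphism.

Lemma swapM f g : swap (f * g) = swap f * swap g. Proof. exact: rmorphM. Qed.
Lemma swapD f g : swap (f + g) = swap f + swap g. Proof. exact: rmorphD. Qed.
Lemma swapXn f n : swap (f ^+ n) = swap f ^+ n. Proof. exact: rmorphXn. Qed.

End Swap.

(** * Divisibility in K[[x,y]] *)

Section Coprimality.
Variable A : comUnitRingType.
Implicit Types a b d : A.

Lemma rcoprimeC a b : rcoprime a b -> rcoprime b a.
Proof. by move=> ab d db da; apply: ab. Qed.

Lemma rdvd_trans d a b : rdvd d a -> rdvd a b -> rdvd d b.
Proof. by move=> [c ->] [e ->]; exists (e * c); rewrite mulrA. Qed.

Lemma rdvd_mull d a b : rdvd d b -> rdvd d (a * b).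
Proof. by move=> [c ->]; exists (a * c); rewrite mulrA. Qed.

Lemma rdvd_mulr d a b : rdvd d a -> rdvd d (a * b).
Proof. by rewrite mulrC; apply: rdvd_mull. Qed.

Lemma rdvdD d a b : rdvd d a -> rdvd d b -> rdvd d (a + b).
Proof. by move=> [c ->] [e ->]; exists (c + e); rewrite mulrDl. Qed.

Lemma rdvdB d a b : rdvd d a -> rdvd d b -> rdvd d (a - b).
Proof. by move=> [c ->] [e ->]; exists (c - e); rewrite mulrBl. Qed.

Lemma rdvd_refl d : rdvd d d. Proof. by exists 1; rewrite mul1r. Qed.

Lemma rirreducible_coprime a b : rirreducible a -> ~ rdvd a b -> rcoprime a b.
Proof.
move=> [_ _ irr] ndvd d [c e] db.
have [uc|//] := irr _ _ e; case: ndvd; move: db => [q ->].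
by exists (q / c); rewrite e mulrA divrK.
Qed.

Lemma rsquarefree_factors a b : rsquarefree (a * b) ->
  [/\ rsquarefree a, rsquarefree b & rcoprime a b].
Proof.
move=> [ab0 sf]; split.
- split=> [|d dd]; first by apply: contraNneq ab0 => ->; rewrite mul0r.
  by apply: sf; apply: rdvd_mulr.
- split=> [|d dd]; first by apply: contraNneq ab0 => ->; rewrite mulr0.
  by apply: sf; apply: rdvd_mull.
- move=> d [p ea] [q eb]; apply: sf; exists (p * q).
  by rewrite ea eb mulrACA.
Qed.

End Coprimality.

Section TwoVariables.
Variable K : fieldType.
Local Notation R := (fps (fps K)).
Implicit Types (d f g u v : R).
Local Notation X := (fpsX (fps K)).
Local Notation Y := (swap X).

Lemma fps2_unitE f : (f \is a GRing.unit) = (f 0%N 0%N != 0).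
Proof. by rewrite !fps_unitE unitfE. Qed.

Lemma swap_unit f : (swap f \is a GRing.unit) = (f \is a GRing.unit).
Proof. by rewrite !fps2_unitE. Qed.

Lemma rdvd_swap d f : rdvd (swap d) (swap f) <-> rdvd d f.
Proof.
split=> [[c e]|[c ->]]; last by exists (swap c); rewrite swapM.
by exists (swap c); apply: (inv_inj (@swapK K)); rewrite swapM e swapK.
Qed.

Lemma rcoprime_swap f g : rcoprime (swap f) (swap g) <-> rcoprime f g.
Proof.
split=> cop d.
  by move=> /rdvd_swap df /rdvd_swap dg; rewrite -swap_unit; apply: cop.
rewrite -{1 2}(swapK d) => /rdvd_swap df /rdvd_swap dg.
by rewrite -swap_unit; apply: cop.
Qed.

Lemma rirreducible_swap f : rirreducible f -> rirreducible (swap f).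
Proof.
move=> [f0 nu irr]; split.
  apply: contraNneq f0 => e.
  by rewrite -(swapK f) e; apply/eqP; exact: raddf0.
  by rewrite swap_unit.
move=> b c e; rewrite -(swap_unit b) -(swap_unit c); apply: irr.
by rewrite -swapM -e swapK.
Qed.

(** Consider the D not divisible by x such that x^k D is in the ideal (f, g)
   for some k, and take one for which D(0, y) has least order. It divides every
   element of the ideal: the remainder of the Weierstrass division of such an
   element by D is, once freed of its powers of x, another such series, of
   smaller order. So D is a unit when f and g are coprime. *)
Lemma rcoprime_bezoutX f g : rcoprime f g ->
  exists k a b, X ^+ k = a * f + b * g.
Proof.
move=> cop.
pose J (D : R) := D 0%N != 0 /\ exists k (a b : R), X ^+ k * D = a * f + b * g.
have [D0 JD0] : exists D, J D.
  have [f0|/fps_factorX[m [f' [e nz]]]] := eqVneq f 0; last first.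
    by exists f'; split=> //; exists m, 1, 0; rewrite mul1r mul0r addr0.
  have [g0|/fps_factorX[m [g' [e nz]]]] := eqVneq g 0; last first.
    by exists g'; split=> //; exists m, 0, 1; rewrite mul1r mul0r add0r.
  have : (0 : R) \is a GRing.unit.
    by apply: cop; rewrite ?f0 ?g0; apply: rdvd_refl.
  by rewrite unitr0.
have exn : exists n, `[< exists D, J D /\ ord (D 0%N) = n >].
  by exists (ord (D0 0%N)); apply/asboolP; exists D0.
case: (ex_minnP exn) => n /asboolP[D [[nz [k [a [b e]]]] ordD]] minD.
have dvdD u : (exists p q : R, u = p * f + q * g) -> rdvd D u.
  move=> [p [q eu]]; have [s [r [es rP]]] := weierstrass_division u nz.
  have [r0|/fps_factorX[m [r' [er nzr]]]] := eqVneq r 0.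
    by exists s; rewrite es r0 addr0.
  have r'E j : r' 0%N j = r m j by rewrite er coef_fpsXnM ltnn subnn.
  have : (ord (r' 0%N) < n)%N.
    rewrite ltnNge -ordD; apply/negP => le; have := coef_ord nzr.
    by rewrite r'E rP ?eqxx.
  rewrite ltnNge => /negP[]; apply: minD; apply/asboolP; exists r'; split=> //.
  split=> //; exists (k + m)%N, (X ^+ k * p - s * a), (X ^+ k * q - s * b).
  rewrite exprD -mulrA -er.
  have -> : r = u - s * D by rewrite es addrC addKr.
  rewrite mulrBr (mulrCA _ s D) e eu !mulrBl !mulrDr !mulrA opprD.
  by rewrite addrACA.
have uD : D \is a GRing.unit.
  apply: cop; apply: dvdD.
    by exists 1, 0; rewrite mul1r mul0r addr0.
  by exists 0, 1; rewrite mul1r mul0r add0r.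
exists k, (D^-1 * a), (D^-1 * b).
by rewrite -!mulrA -mulrDr -e mulrCA mulVr ?mulr1.
Qed.

(** Euclid's lemma. By the previous lemma and its mirror image, f divides both
   x^k v and y^l v; cancelling f in y^l (x^k v) = x^k (y^l v) shows that the
   first quotient is a multiple of x^k. *)
Lemma rdvd_coprime_mul f u v : rcoprime f u -> rdvd f (u * v) -> rdvd f v.
Proof.
move=> cop [w euv].
move: cop euv; case: (eqVneq f 0) => [->|f0] cop euv.
  exists 0; move/eqP: euv; rewrite mulr0 mulf_eq0 => /orP[/eqP u0|/eqP->];
    last by rewrite mulr0.
  have : (0 : R) \is a GRing.unit.
    by apply: cop; rewrite ?u0; apply: rdvd_refl.
  by rewrite unitr0.
have dvd_pow Z k a b : Z ^+ k = a * f + b * u -> exists c, Z ^+ k * v = c * f.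
  move=> ->; exists (a * v + b * w).
  by rewrite !mulrDl -!mulrA euv (mulrC f v).
have [k [a [b /dvd_pow[c ec]]]] := rcoprime_bezoutX cop.
have /rcoprime_swap/rcoprime_bezoutX[l [a' [b' e']]] := cop.
have /dvd_pow[c' ec'] : Y ^+ l = swap a' * f + swap b' * u.
  by rewrite -swapXn e' swapD !swapM !swapK.
have ecc : Y ^+ l * c = X ^+ k * c'.
  by apply: (mulIf f0); rewrite -!mulrA -ec -ec' mulrCA.
have /fps_cutE cE i : (i < k)%N -> c i = 0.
  move=> ik; apply/fpsP => j.
  transitivity ((Y ^+ l * c) i (j + l)%N); last by rewrite ecc coef_fpsXnM ik.
  transitivity ((X ^+ l * swap c) (j + l)%N i).
    by rewrite coef_fpsXnM ltnNge leq_addl addnK.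
  transitivity (swap (X ^+ l * swap c) i (j + l)%N) => //.
  by rewrite swapM swapXn swapK.
exists (FPS (fun n => c (n + k)%N)).
by apply: (mulfI (expf_neq0 k (fpsX_neq0 _))); rewrite ec {1}cE mulrA.
Qed.

Lemma rcoprime_mul f g u : rcoprime u f -> rcoprime u g -> rcoprime u (f * g).
Proof.
move=> uf ug d du dfg; apply: ug => //.
apply: rdvd_coprime_mul dfg => e ed ef.
by apply: uf => //; apply: rdvd_trans du.
Qed.

(** The pair (order in x, order in y of the leading coefficient) is a
   lexicographic valuation; the sum of its entries bounds the number of
   factors. *)
Definition weight f := (ord f + ord (lead f))%N.

Lemma weightM f g : f != 0 -> g != 0 -> weight (f * g) = (weight f + weight g)%N.
Proof.
by move=> f0 g0; rewrite /weight leadM // !ordM ?lead_neq0 // addnACA.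
Qed.

Lemma weight_gt0 f : f != 0 -> f \isn't a GRing.unit -> (0 < weight f)%N.
Proof.
move=> f0; apply: contraNltn; rewrite leqn0 addn_eq0 => /andP[/eqP o1 /eqP o2].
have := lead_neq0 (lead_neq0 f0).
by rewrite fps2_unitE {1}/lead o2 /lead o1.
Qed.

(** A squarefree series that is not irreducible is a product of two coprime
   squarefree series of smaller weight. *)
Lemma squarefree_ind (P : R -> Prop) :
    (forall f, rirreducible f -> P f) ->
    (forall f g, rcoprime f g -> P f -> P g -> P (f * g)) ->
  forall f, rsquarefree f -> f \isn't a GRing.unit -> P f.
Proof.
move=> Pirr PM f; have [n le_n] := ubnP (weight f).
elim: n => // n IH in f le_n * => sf nu.
have [irr|nirr] := pselect (rirreducible f); first exact: Pirr.
have [b [c [e ub uc]]] : exists b c,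
    [/\ f = b * c, b \isn't a GRing.unit & c \isn't a GRing.unit].
  apply: contrapT => no; apply: nirr; split=> //; first by case: sf.
  move=> b c e; apply: contrapT => /not_orP[/negP ub /negP uc].
  by apply: no; exists b, c.
move: le_n sf; rewrite e => le_n sf.
have [[b0 _] [c0 _] _] := rsquarefree_factors sf.
have [sb sc cop] := rsquarefree_factors sf.
move: le_n; rewrite weightM // ltnS => le_n.
apply: PM => //; apply: IH => //; apply: leq_trans le_n.
  by rewrite -ltn_subLR // subnn weight_gt0.
by rewrite -[X in (X < _)%N]add0n ltn_add2r weight_gt0.
Qed.

End TwoVariables.

(** * Codimension *)

Section Codimension.
Variables (K : fieldType) (T : comNzRingType) (io : {rmorphism K -> T}).
Variable V : lmodType T.
Implicit Types (I J : V -> Prop) (u v : V).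

Definition subspace I :=
  [/\ I 0, forall u v, I u -> I v -> I (u - v) &
      forall a u, I u -> I (io a *: u)].

Lemma subspaceB I u v : subspace I -> I u -> I v -> I (u - v).
Proof. by case=> _ sB _; apply: sB. Qed.

Lemma subspaceN I u : subspace I -> I u -> I (- u).
Proof. by case=> s0 sB _ Iu; rewrite -sub0r; apply: sB. Qed.

Lemma subspaceD I u v : subspace I -> I u -> I v -> I (u + v).
Proof.
by move=> sI Iu Iv; rewrite -[v]opprK; apply: subspaceB => //; apply: subspaceN.
Qed.

Definition comb n (c : 'rV[K]_n) (e : 'I_n -> V) := \sum_k io (c 0 k) *: e k.

Lemma subspace_comb I n (c : 'rV_n) e :
  subspace I -> (forall k, I (e k)) -> I (comb c e).
Proof.
move=> sI Ie; have [I0 _ IZ] := sI.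
rewrite /comb; elim/big_ind: _ => // [u v|k _]; first exact: subspaceD.
exact: IZ.
Qed.

Lemma combB n (c : 'rV_n) e e' :
  comb c (fun k => e k - e' k) = comb c e - comb c e'.
Proof.
by rewrite /comb -sumrB; apply: eq_bigr => k _; rewrite scalerBr.
Qed.

Lemma comb_comb m n (c : 'rV_m) (B : 'M_(m, n)) e :
  comb c (fun k => comb (row k B) e) = comb (c *m B) e.
Proof.
rewrite /comb; under eq_bigr do rewrite scaler_sumr.
rewrite exchange_big; apply: eq_bigr => l _ /=.
rewrite mxE rmorph_sum scaler_suml; apply: eq_bigr => k _.
by rewrite scalerA rmorphM mxE.
Qed.

Lemma comb_delta n (k : 'I_n) e : comb (delta_mx 0 k) e = e k.
Proof.
rewrite /comb (bigD1 k) //= mxE !eqxx rmorph1 scale1r big1 ?addr0 // => l lk.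
by rewrite mxE (negPf lk) rmorph0 scale0r.
Qed.

Lemma comb_split m n (c : 'rV_m) (d : 'rV_n) e0 e1 :
  comb (row_mx c d) (fun k => match split k with inl a => e0 a | inr b => e1 b end)
  = comb c e0 + comb d e1.
Proof.
rewrite /comb big_split_ord /=; congr (_ + _); apply: eq_bigr => k _.
  by rewrite row_mxEl (unsplitK (inl k)).
by rewrite row_mxEr (unsplitK (inr k)).
Qed.

(** The dimension of J/I over K: e lifts a basis. For J the whole space and I
   an ideal this is the shape of an intersection number; the relative form is
   what makes dimensions add up along I <= J <= V. *)
Definition codim J I n := exists e : 'I_n -> V, (forall k, J (e k)) /\
  forall u, J u -> exists! c : 'rV[K]_n, I (u - comb c e).

Definition full u := True.

(** The matrices of change of basis compose to the identity. *)
Lemma codim_le I m n :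
  subspace I -> codim full I m -> codim full I n -> (m <= n)%N.
Proof.
move=> sI [e [_ eP]] [e' [_ e'P]].
have [a aP] := choice (fun k => e'P (e k) Logic.I).
have [b bP] := choice (fun k => eP (e' k) Logic.I).
pose A := \matrix_k a k; pose B := \matrix_k b k.
apply: (@mulmx1_min _ _ _ A B); apply/row_matrixP => k.
rewrite row_mul row1 rowK.
have [c [_ cU]] := eP (e k) Logic.I.
transitivity c; last by apply: cU; rewrite comb_delta subrr; case: sI.
apply/esym/cU; rewrite -comb_comb -(subrKA (comb (a k) e')).
apply: (subspaceD sI); first by case: (aP k).
rewrite -combB; apply: subspace_comb => // l.
by rewrite rowK; case: (bP l).
Qed.

Lemma codim_uniq I m n :
  subspace I -> codim full I m -> codim full I n -> m = n.
Proof.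
by move=> sI Im In; apply/eqP; rewrite eqn_leq !(@codim_le I).
Qed.

Lemma codim_chain I J m n : subspace J -> (forall u, I u -> J u) ->
  codim full J m -> codim J I n -> codim full I (m + n).
Proof.
move=> sJ IJ [e0 [_ e0P]] [e1 [Je1 e1P]].
exists (fun k => match split k with inl a => e0 a | inr b => e1 b end).
split=> // u _; have [c [Jc cU]] := e0P u Logic.I.
have [d [Id dU]] := e1P _ Jc; exists (row_mx c d); split.
  by rewrite comb_split opprD addrA.
move=> cd; rewrite -[cd]hsubmxK comb_split opprD addrA => Icd.
have ec : c = lsubmx cd.
  apply: cU; rewrite -[_ - _](subrK (comb (rsubmx cd) e1)).
  by apply: subspaceD => //; [exact: IJ | exact: subspace_comb].
by rewrite -ec; congr row_mx; apply: dU; rewrite ec.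
Qed.

End Codimension.

Arguments full {T V} u.

(** phi induces an isomorphism from V/I to J'/I'; the rings acting on V and V'
   may differ as long as both contain K. *)
Lemma codim_transport (K : fieldType) (T T' : comNzRingType)
    (io : {rmorphism K -> T}) (io' : {rmorphism K -> T'})
    (V : lmodType T) (V' : lmodType T') (phi : V -> V')
    (I : V -> Prop) (J' I' : V' -> Prop) n :
    {morph phi : u v / u - v} -> (forall a u, phi (io a *: u) = io' a *: phi u) ->
    subspace io' I' ->
    (forall u, J' (phi u)) -> (forall u', J' u' -> exists u, I' (u' - phi u)) ->
    (forall u, I u <-> I' (phi u)) ->
  codim io full I n -> codim io' J' I' n.
Proof.
move=> phiB phiZ sI' J'phi onto iff [e [_ eP]].
have phi0 : phi 0 = 0 by rewrite -(subrr 0) phiB subrr.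
have phiD : {morph phi : u v / u + v}.
  move=> u v; have phiN : phi (- v) = - phi v by rewrite -sub0r phiB phi0 sub0r.
  by rewrite -{1}[v]opprK phiB phiN opprK.
have phi_comb c : phi (comb io c e) = comb io' c (phi \o e).
  by rewrite /comb (big_morph phi phiD phi0); apply: eq_bigr => k _.
exists (phi \o e); split=> [k|u' /onto[u Iu]]; first exact: J'phi.
have shift c : I (u - comb io c e) <-> I' (u' - comb io' c (phi \o e)).
  rewrite iff phiB phi_comb; split=> h.
    by rewrite -(subrKA (phi u)); exact: (subspaceD sI' Iu h).
  rewrite -(subrKA u'); apply: (subspaceD sI' _ h).
  by rewrite -opprB; apply: (subspaceN sI').
have [c [Ic cU]] := eP u Logic.I; exists c; split; first exact/shift.
by move=> d /shift /cU.
Qed.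

(** * Cokernels of matrices over K[[x]] *)

Section Cokernel.
Variables (K : fieldType) (d : nat).
Local Notation S := (fps K).
Local Notation io := (@fpsC K : {rmorphism K -> S}).
Implicit Types (M : 'M[S]_d) (v w : 'rV[S]_d).

Definition row_space M (v : 'rV[S]_d) := exists w, v = w *m M.

Lemma row_space_subspace M : subspace io (row_space M).
Proof.
split; first by exists 0; rewrite mul0mx.
  by move=> u v [a ->] [b ->]; exists (a - b); rewrite mulmxBl.
by move=> a u [w ->]; exists (fpsC a *: w); rewrite scalemxAl.
Qed.

Lemma mulmx_det_inj M v : \det M != 0 -> v *m M = 0 -> v = 0.
Proof.
move=> dM e; apply: contrapT => /eqP v0; case/negP: dM.
by apply/det0P; exists v.
Qed.

(** The row space of M is the image by M' of the vectors whose entry i0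
   vanishes at 0, a hyperplane condition. *)
Lemma codim_row_space_shift M M' (T : 'M[K]_d) i0 n :
    T \in unitmx -> \det M' != 0 ->
    map_mx (@fpsC K) T *m M =
      \matrix_(i, j) (if i == i0 then fpsX K * M' i j else M' i j) ->
    codim io full (row_space M') n ->
  codim io full (row_space M) (n + 1).
Proof.
set TS := map_mx _ T => uT dM' eM.
have uTS : TS \in unitmx by rewrite map_unitmx.
pose E : 'rV[S]_d := \row_i (if i == i0 then fpsX K else 1).
have eE : TS *m M = diag_mx E *m M'.
  rewrite eM; apply/matrixP => i j; rewrite mul_diag_mx !mxE.
  by case: eqP; rewrite ?mul1r.
have MM' v : row_space M v -> row_space M' v.
  move=> [w ->]; exists (w *m invmx TS *m diag_mx E).
  by rewrite -!mulmxA -eE !mulmxA mulmxKV.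
move=> /codim_chain; apply; [exact: row_space_subspace | exact: MM' |].
apply: (@codim_transport _ _ _ io io _ _ (mulmxr M') (fun v => v 0 i0 0%N = 0)).
- by move=> u v; rewrite /= mulmxBl.
- by move=> a u; rewrite /= scalemxAl.
- exact: row_space_subspace.
- by move=> u; exists u.
- move=> _ [w ->]; exists w; rewrite /= subrr.
  by case: (row_space_subspace M).
- move=> u; split=> [u0|[w /= e]].
    pose q : 'rV[S]_d :=
      \row_i (if i == i0 then FPS (fun n => u 0 i n.+1) else u 0 i).
    have -> : u = q *m diag_mx E.
      apply/rowP => i; rewrite mul_mx_diag !mxE; case: eqP => [->|_].
        by apply/fpsP => -[|k]; rewrite mulrC coef_fpsXM.
      by rewrite mulr1.
    by exists (q *m TS); rewrite /= -!mulmxA -eE mulmxA.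
  have e' : (u - w *m invmx TS *m diag_mx E) *m M' = 0.
    by rewrite mulmxBl e -!mulmxA -eE !mulmxA mulmxKV ?subrr.
  have /eqP := mulmx_det_inj dM' e'.
  rewrite subr_eq0 => /eqP ->.
  by rewrite mul_mx_diag !mxE eqxx mulrC coef_fpsXM.
- exists (fun=> delta_mx 0 i0); split=> // u _.
  have coefE (c : 'rV[K]_1) :
      (u - comb io c (fun=> delta_mx 0 i0)) 0 i0 0%N = u 0 i0 0%N - c 0 0.
    by rewrite /comb big_ord1 !mxE !eqxx mulr1.
  exists (const_mx (u 0 i0 0%N)); split=> [|c].
    by rewrite coefE mxE subrr.
  rewrite coefE => /eqP; rewrite subr_eq0 => /eqP ->.
  by apply/rowP => k; rewrite mxE (ord1 k).
Qed.

(** The length of the cokernel of an injective endomorphism of a free module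
   over a discrete valuation ring is the order of its determinant. If the
   determinant vanishes at 0, some nonzero constant combination of the rows is
   divisible by x; putting it in place of a row and dividing it by x lowers by
   one both the order of the determinant and the codimension of the row
   space. *)
Lemma codim_row_space M n :
    (forall k, (k < n)%N -> (\det M) k = 0) -> (\det M) n != 0 ->
  codim io full (row_space M) n.
Proof.
elim: n M => [|n IH] M low dMn.
  have uM : M \in unitmx by rewrite unitmxE fps_unitE unitfE.
  exists (fun=> 0); split=> // u _; exists 0; split=> [|c _].
    by rewrite /comb big_ord0 subr0; exists (u *m invmx M); rewrite mulmxKV.
  by apply/rowP => -[].
have /det0P[c c0 cM] : \det (map_mx (@fps_ev0 K) M) == 0.
  by rewrite det_map_mx; apply/eqP; apply: low.
have [i0 ci0] : exists i0, c 0 i0 != 0 by apply/rV0Pn.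
have ee : (delta_mx 0 i0 : 'rV[K]_d) *m (delta_mx i0 0 : 'cV[K]_d) = 1%:M.
  by rewrite mul_delta_mx; apply/matrixP => i j; rewrite !mxE !ord1.
(* T is an invertible constant matrix whose row i0 is c. *)
have rk : \rank ((delta_mx 0 i0 : 'rV[K]_d) *m ((delta_mx i0 0 : 'cV[K]_d) *m c))
    = \rank (delta_mx 0 i0 : 'rV[K]_d).
  rewrite mulmxA ee mul1mx mxrank_delta; apply/eqP.
  by rewrite eqn_leq rank_leq_row lt0n mxrank_eq0.
have [T uT] := complete_unitmx rk.
rewrite mulmxA ee mul1mx -rowE => eT.
set TS := map_mx (@fpsC K) T.
have TM0 j : (TS *m M) i0 j 0%N = 0.
  transitivity (fps_ev0 (row i0 (TS *m M) 0 j)); first by rewrite [row _ _ _ _]mxE.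
  rewrite row_mul -map_row -eT.
  have /rowP/(_ j) := cM; rewrite !mxE rmorph_sum => {2}<-.
  by apply: eq_bigr => k _; rewrite !mxE rmorphM.
pose M' := \matrix_(i, j) (if i == i0 then FPS (fun n => (TS *m M) i j n.+1)
                            else (TS *m M) i j).
have eM : TS *m M = \matrix_(i, j) (if i == i0 then fpsX K * M' i j else M' i j).
  apply/matrixP => i j; rewrite [RHS]mxE [M' i j]mxE; case: eqP => [->|//].
  by apply/fpsP => -[|k]; rewrite coef_fpsXM ?TM0.
have eD : fpsC (\det T) * \det M = fpsX K * \det M'.
  rewrite -det_map_mx -det_mulmx -/TS.
  have -> : TS *m M = diag_mx (\row_i (if i == i0 then fpsX K else 1)) *m M'.
    rewrite {1}eM; apply/matrixP => i j; rewrite mul_diag_mx !mxE.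
    by case: eqP; rewrite ?mul1r.
  rewrite det_mulmx det_diag (bigD1 i0) //= mxE eqxx big1 ?mulr1 // => i ne.
  by rewrite mxE (negPf ne).
have detM' k : (\det M') k = \det T * (\det M) k.+1.
  by rewrite -coef_fpsCM eD coef_fpsXM.
have dM'n : (\det M') n != 0.
  by rewrite detM' mulf_neq0 // -unitfE -unitmxE.
have -> : n.+1 = (n + 1)%N by rewrite addn1.
apply: (codim_row_space_shift uT _ eM).
  by apply: contraNneq dM'n => ->.
by apply: IH => // k kn; rewrite detM' low ?mulr0.
Qed.

End Cokernel.

(** * Intersection numbers *)

Section IntersectionNumbers.
Variable R : realType.
Implicit Types (f g h u v : cseries R) (a b c t : R[i]) (n : nat).

HB.instance Definition _ := GRing.RMorphism.copy (@cseriesC R)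
  (@fpsC (fps R[i]) \o @fpsC R[i]).

Local Notation io := (@cseriesC R : {rmorphism R[i] -> cseries R}).

Lemma swap_cseriesC c : swap (cseriesC c) = cseriesC c.
Proof. by apply/fpsP => -[|i]; apply/fpsP => -[|j]. Qed.

Lemma in_ideal2_subspace g h :
  @subspace _ _ io (cseries R)^o (in_ideal2 g h).
Proof.
split; first by exists 0, 0; rewrite !mul0r addr0.
  move=> u v [r [s ->]] [r' [s' ->]]; exists (r - r'), (s - s').
  by rewrite !mulrBl opprD addrACA.
move=> a u [r [s ->]]; exists (io a * r), (io a * s).
by rewrite -!mulrA -mulrDr.
Qed.

Lemma int_numberE g h n :
  int_number g h n <-> @codim _ _ io (cseries R)^o full (in_ideal2 g h) n.
Proof.
split=> [[e eP]|[e [_ eP]]]; exists e; last by move=> u; apply: eP.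
by split=> // u _; apply: eP.
Qed.

Lemma int_number_uniq g h m n : int_number g h m -> int_number g h n -> m = n.
Proof.
move=> /int_numberE Im /int_numberE; apply: codim_uniq Im.
exact: in_ideal2_subspace.
Qed.

Lemma int_number_ext g h g' h' n :
    (forall u, in_ideal2 g h u <-> in_ideal2 g' h' u) ->
  int_number g h n -> int_number g' h' n.
Proof.
move=> E [e eP]; exists e => u; have [c [Ic cU]] := eP u.
by exists c; split=> [|d /E]; [apply/E | apply: cU].
Qed.

Lemma int_numberC g h n : int_number g h n -> int_number h g n.
Proof.
by apply: int_number_ext => u; split=> -[r [s ->]]; exists s, r; rewrite addrC.
Qed.

Lemma int_number_mod g h q n :
  int_number g h n -> int_number (g + q * h) h n.
Proof.
apply: int_number_ext => u; split=> -[r [s ->]].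
  by exists r, (s - r * q); rewrite mulrDr mulrBl mulrA addrACA subrr addr0.
by exists r, (r * q + s); rewrite mulrDr mulrDl mulrA addrA.
Qed.

Lemma int_number_unit v g h n : v \is a GRing.unit ->
  int_number g h n -> int_number (v * g) h n.
Proof.
move=> uv; apply: int_number_ext => u; split=> -[r [s ->]].
  by exists (r / v), s; rewrite mulrA divrK.
by exists (r * v), s; rewrite mulrA.
Qed.

Lemma int_number_swap g h n :
  int_number (swap g) (swap h) n -> int_number g h n.
Proof.
move=> /int_numberE I; apply/int_numberE.
apply: (@codim_transport _ _ _ io io (cseries R)^o (cseries R)^o (@swap R[i])
  (in_ideal2 (swap g) (swap h))) I => //.
- by move=> a u; rewrite [LHS]swapM swap_cseriesC.
- exact: in_ideal2_subspace.
- by move=> u _; exists (swap u); rewrite swapK subrr; exists 0, 0;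
  rewrite !mul0r addr0.
- move=> u; split=> -[r [s e]]; exists (swap r), (swap s).
    by rewrite e swapD !swapM !swapK.
  by apply: (inv_inj (@swapK R[i])); rewrite e swapD !swapM !swapK.
Qed.

(** Multiplication by u embeds C[[x,y]]/(v, f) in C[[x,y]]/(u v, f) with
   cokernel C[[x,y]]/(u, f); it is injective since u is not a zero divisor
   modulo f. *)
Lemma int_numberM u v f m n : rcoprime f u ->
  int_number u f m -> int_number v f n -> int_number (u * v) f (m + n).
Proof.
move=> cop /int_numberE Iu /int_numberE Iv; apply/int_numberE.
have idealM r : in_ideal2 v f r <-> in_ideal2 (u * v) f (u * r).
  split=> -[a [b e]].
    exists a, (u * b); rewrite e mulrDr (mulrCA u a v) (mulrA u b f).
    reflexivity.
  have [||c ec] := @rdvd_coprime_mul _ f u (r - a * v) => //.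
    by exists b; rewrite mulrBr e mulrCA addrAC subrr add0r.
  by exists a, c; rewrite -ec addrC subrK.
apply: codim_chain (in_ideal2_subspace u f) _ Iu _.
  by move=> r [a [b ->]]; exists (a * v), b; rewrite -mulrA (mulrC v).
apply: (@codim_transport _ _ _ io io (cseries R)^o (cseries R)^o ( *%R u)
  (in_ideal2 v f)) Iv.
- by move=> r s; rewrite mulrBr.
- by move=> a r; apply: mulrCA.
- exact: in_ideal2_subspace.
- by move=> r; exists r, 0; rewrite mul0r addr0 mulrC.
- move=> _ [r [s ->]]; exists r; exists 0, s.
  by rewrite (mulrC u) addrAC subrr mul0r.
- exact: idealM.
Qed.

End IntersectionNumbers.

(** * Multiplication modulo a series regular in y *)

Section RegularSeries.
Variables (R : realType) (f : cseries R).
Hypothesis f_reg : f 0%N != 0.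
Implicit Types u : cseries R.
Local Notation S := (fps R[i]).
Local Notation d := (ord (f 0%N)).

(** The entries of v are the coefficients, in C[[x]], of a polynomial in y of
   degree less than d. *)
Definition ypoly (v : 'rV[S]_d) : cseries R :=
  swap (FPS (fun j => if insub j is Some k then v 0 k else 0)).

Lemma ypoly_zmod_morphism : zmod_morphism ypoly.
Proof.
move=> v w; apply/fpsP => i; apply/fpsP => j /=.
by case: insub => [k|]; rewrite ?mxE ?subr0.
Qed.
HB.instance Definition _ :=
  GRing.isZmodMorphism.Build _ _ ypoly ypoly_zmod_morphism.

Lemma ypolyZ (s : S) v : ypoly (s *: v) = swap (fpsC s) * ypoly v.
Proof.
rewrite /ypoly -swapM; congr swap; apply/fpsP => j; rewrite coef_fpsCM /=.
by case: insub => [k|]; rewrite ?mxE ?mulr0.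
Qed.

Lemma ypoly_onto u : exists v, rdvd f (u - ypoly v).
Proof.
have [q [r [e rP]]] := weierstrass_division u f_reg.
exists (\row_k swap r k), q; apply/eqP; rewrite e subr_eq addrC.
have -> : ypoly (\row_k swap r k) = r; last by rewrite addrC.
apply/fpsP => i; apply/fpsP => j /=; case: insubP => [k _ <-|].
  by rewrite mxE.
by rewrite -leqNgt => /rP ->.
Qed.

Lemma ypoly_inj v : rdvd f (ypoly v) -> v = 0.
Proof.
move=> [q e].
have q0 : q = 0.
  apply: (weierstrass_uniq f_reg) => i j dj; rewrite -e /=.
  by rewrite insubF // ltnNge dj.
move: e; rewrite q0 mul0r => e; apply/rowP => k; rewrite mxE; apply/fpsP => i.
by have /fpsP/(_ i)/fpsP/(_ k) := e; rewrite /= valK.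
Qed.

Definition yrem u := projT1 (cid (ypoly_onto u)).

Lemma yremP u : rdvd f (u - ypoly (yrem u)).
Proof. by rewrite /yrem; case: cid. Qed.

(** The matrix of the multiplication by u on C[[x,y]]/(f), in the basis
   1, y, ..., y^(d-1) over C[[x]], acting on row vectors. *)
Definition mulmat u : 'M[S]_d := \matrix_k yrem (ypoly (delta_mx 0 k) * u).

Lemma ypoly_comb m (s : 'rV[S]_m) (A : 'M[S]_(m, d)) :
  ypoly (s *m A) = \sum_k swap (fpsC (s 0 k)) * ypoly (row k A).
Proof.
rewrite mulmx_sum_row (raddf_sum ypoly).
apply: eq_bigr => k _.
exact: ypolyZ.
Qed.

Lemma mulmatP u v : rdvd f (ypoly v * u - ypoly (v *m mulmat u)).
Proof.
have -> : ypoly v * u - ypoly (v *m mulmat u) = \sum_k swap (fpsC (v 0 k)) *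
    (ypoly (delta_mx 0 k) * u - ypoly (yrem (ypoly (delta_mx 0 k) * u))).
  rewrite (ypoly_comb v (mulmat u)) -{1}[v]mulmx1 (ypoly_comb v 1%:M).
  rewrite mulr_suml -sumrB.
  apply: eq_bigr => k _.
  rewrite row1 rowK mulrBr -mulrA.
  reflexivity.
elim/big_ind: _ => [|a b|k _]; [by exists 0; rewrite mul0r | exact: rdvdD |].
exact/rdvd_mull/yremP.
Qed.

(** A polynomial of degree less than d is determined by its class modulo f. *)
Lemma mulmat_uniq u (M : 'M[S]_d) :
  (forall v, rdvd f (ypoly v * u - ypoly (v *m M))) -> M = mulmat u.
Proof.
move=> MP; apply/row_matrixP => k; apply/eqP; rewrite -subr_eq0; apply/eqP.
apply: ypoly_inj; rewrite !rowE raddfB /=.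
rewrite -(subrKA (ypoly (delta_mx 0 k) * u)) -opprB addrC; apply: rdvdB.
  exact: mulmatP.
exact: MP.
Qed.

Lemma mulmat_pencil u (v : cseries R) (t : R[i]) :
  mulmat (u + cseriesC t * v) = mulmat u + fpsC t *: mulmat v.
Proof.
apply/esym/mulmat_uniq => w.
have -> : ypoly w * (u + cseriesC t * v) - ypoly (w *m (mulmat u + fpsC t *: mulmat v))
   = (ypoly w * u - ypoly (w *m mulmat u)) +
     cseriesC t * (ypoly w * v - ypoly (w *m mulmat v)).
  rewrite mulmxDr -scalemxAr raddfD /= ypolyZ.
  rewrite -/(cseriesC t) swap_cseriesC.
  by rewrite mulrDr mulrCA mulrBr opprD addrACA.
by apply: rdvdD; [|apply: rdvd_mull]; apply: mulmatP.
Qed.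

(** By Euclid's lemma, u is not a zero divisor modulo f. *)
Lemma det_mulmat_neq0 u : rcoprime f u -> \det (mulmat u) != 0.
Proof.
move=> cop; apply/det0P => -[v v0 e]; case/eqP: v0; apply: ypoly_inj.
apply: (rdvd_coprime_mul cop); rewrite mulrC.
by have := mulmatP u v; rewrite e raddf0 subr0.
Qed.

Lemma det_mulmat_dvd u : (0 < d)%N -> rdvd f u -> \det (mulmat u) = 0.
Proof.
move=> d0 fu; have <- : 0 = mulmat u.
  by apply: mulmat_uniq => v; rewrite mulmx0 raddf0 subr0; apply: rdvd_mull.
apply/eqP/det0P; exists (const_mx 1); last by rewrite mulmx0.
by apply/rV0Pn; exists (Ordinal d0); rewrite mxE oner_neq0.
Qed.

(** [ypoly] identifies C[[x,y]]/(f) with C[[x]]^d and the ideal generated by u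
   with the row space of its matrix. *)
Lemma int_number_mulmat u n : (forall k, (k < n)%N -> (\det (mulmat u)) k = 0) ->
  (\det (mulmat u)) n != 0 -> int_number u f n.
Proof.
move=> low dn; apply/int_numberE.
apply: (@codim_transport _ _ _ (@fpsC R[i]) (@cseriesC R) 'rV[S]_d (cseries R)^o
  ypoly (row_space (mulmat u))) (codim_row_space low dn).
- exact: ypoly_zmod_morphism.
- by move=> a v; rewrite ypolyZ -/(cseriesC a) swap_cseriesC.
- exact: in_ideal2_subspace.
- by [].
- move=> r _; have [v [q e]] := ypoly_onto r; exists v, 0, q.
  by rewrite mul0r add0r.
- move=> v; split=> [[w ->]|[r [s e]]].
    have [q eq] := mulmatP u w; exists (ypoly w), (- q).
    by rewrite mulNr -eq opprB addrC subrK.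
  have [w [q eq]] := ypoly_onto r; exists w.
  apply/eqP; rewrite -subr_eq0; apply/eqP/ypoly_inj; rewrite raddfB /=.
  rewrite -(subrKA (ypoly w * u)); apply: rdvdD; last exact: mulmatP.
  exists (s + q * u); rewrite e mulrDl -mulrA (mulrC u f) mulrA -eq mulrBl.
  by rewrite addrAC addrC.
Qed.

End RegularSeries.

(** * Generic members of a pencil *)

Section Pencils.
Variable R : realType.
Implicit Types (f g h : cseries R) (t : R[i]).

(** The determinant is D.[t] for a polynomial D over C[[x]]; the n-th
   coefficient of D.[t] is a polynomial in t, and the first of these that is
   not zero has finitely many roots. *)
Lemma pencil_order f (f_reg : f 0%N != 0) (p q : cseries R) t0 :
    \det (mulmat f_reg (p + cseriesC t0 * q)) != 0 ->
  exists n (rs : seq R[i]), forall t, t \notin rs ->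
    (forall k, (k < n)%N -> (\det (mulmat f_reg (p + cseriesC t * q))) k = 0) /\
    (\det (mulmat f_reg (p + cseriesC t * q))) n != 0.
Proof.
pose D := \det (map_mx polyC (mulmat f_reg p) + 'X *: map_mx polyC (mulmat f_reg q)).
have DE t : \det (mulmat f_reg (p + cseriesC t * q)) = D.[fpsC t].
  rewrite -horner_evalE -det_map_mx mulmat_pencil; congr (\det _).
  by apply/matrixP => i j; rewrite !mxE /= horner_evalE !hornerE.
pose coefD n := \poly_(k < size D) D`_k n.
have coefDE n t : D.[fpsC t] n = (coefD n).[t].
  rewrite horner_coef coef_fps_sum horner_poly; apply: eq_bigr => k _.
  by rewrite -rmorphXn mulrC coef_fpsCM mulrC.
move=> nz0.
have [n0 nz1] := fps_neq0P nz0.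
have nz : (coefD n0).[t0] != 0 by rewrite -coefDE -DE.
have exn : exists n, coefD n != 0.
  by exists n0; apply: contraNneq nz => ->; rewrite horner0.
case: (ex_minnP exn) => n Dn minn.
have [rs eD] := closed_field_poly_normal (coefD n).
exists n, rs => t trs; split=> [k kn|].
  have /eqP Dk : coefD k == 0.
    by apply: contraTT kn => /minn; rewrite -leqNgt.
  by rewrite DE coefDE Dk horner0.
rewrite DE coefDE eD hornerZ mulf_neq0 ?lead_coef_eq0 //.
by rewrite -/(root _ t) root_prod_XsubC.
Qed.

Lemma generic_P1_and (Phi Psi : R[i] -> R[i] -> Prop) :
  generic_P1 Phi -> generic_P1 Psi -> generic_P1 (fun a b => Phi a b /\ Psi a b).
Proof.
move=> [s s0 sP] [r r0 rP]; exists (s ++ r).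
  by rewrite mem_cat negb_or s0.
move=> a b ab abP; split; [apply: sP|apply: rP] => // q qs.
  by apply: abP; rewrite mem_cat qs.
by apply: abP; rewrite mem_cat qs orbT.
Qed.

Lemma generic_P1_mono (Phi Psi : R[i] -> R[i] -> Prop) :
  (forall a b, Phi a b -> Psi a b) -> generic_P1 Phi -> generic_P1 Psi.
Proof. by move=> PP [s s0 sP]; exists s => // a b ab /(sP a b ab)/PP. Qed.

(** C is infinite, so some (1 : k) avoids the excluded points. *)
Lemma generic_P1_ex (Phi : R[i] -> R[i] -> Prop) :
  generic_P1 Phi -> exists a b, Phi a b.
Proof.
move=> [s s0 sP]; pose bad := [seq q.2 / q.1 | q <- s].
have [k kbad] : exists k : nat, k%:R \notin bad.
  apply: contrapT => no.
  have : (size [seq k%:R : R[i] | k <- iota 0 (size bad).+1] <= size bad)%N.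
    apply: uniq_leq_size.
      by rewrite map_inj_uniq ?iota_uniq // => i j /eqP; rewrite eqr_nat => /eqP.
    by move=> _ /mapP[k _ ->]; apply/negPn/negP => kb; apply: no; exists k.
  by rewrite size_map size_iota ltnn.
exists 1, k%:R; apply: sP; first by rewrite xpair_eqE oner_eq0.
move=> [q1 q2] /= qs; rewrite mul1r; apply/eqP => e.
have [q10|q10] := eqVneq q1 0.
  by move: s0; rewrite -{2}(mulr0 k%:R) -{1}q10 -{1}q10 -e qs.
by case/negP: kbad; apply/mapP; exists (q1, q2) => //=; rewrite e mulfK.
Qed.

Lemma generic_P1_line (Phi : R[i] -> R[i] -> Prop) (rs : seq R[i]) :
    (forall a t, a != 0 -> t \notin rs -> Phi a (a * t)) ->
  generic_P1 Phi.
Proof.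
move=> PhiP; exists ((0, 1) :: [seq (1, t) | t <- rs]).
  rewrite inE xpair_eqE eqxx eq_sym oner_eq0 /=; apply/mapP => -[t _ [/eqP]].
  by rewrite eq_sym oner_eq0.
move=> a b ab abP.
have a0 : a != 0 by have := abP _ (mem_head _ _); rewrite mulr1 mulr0.
rewrite -[b](divfK a0) mulrC; apply: PhiP => //; apply/negP => brs.
have := abP (1, b / a); rewrite inE map_f ?orbT //= => /(_ isT).
by rewrite mulrC divfK // mulr1 eqxx.
Qed.

(** Coprimality is recorded with the intersection number because additivity
   in f needs it. *)
Definition polar_coprime w f n := generic_P1 (fun a b =>
  rcoprime (polar w a b) f /\ int_number (polar w a b) f n).

Lemma polar_coprime_int w f n : polar_coprime w f n -> polar_int_number w f n.
Proof. by apply: generic_P1_mono => a b []. Qed.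

Lemma polar_swap (p q : cseries R) (a b : R[i]) :
  polar (swap p, swap q) a b = swap (polar (p, q) a b).
Proof. by rewrite /polar /= swapD !swapM !swap_cseriesC. Qed.

Lemma cseriesC_unit (a : R[i]) : a != 0 -> cseriesC a \is a GRing.unit.
Proof. by move=> a0; rewrite fps2_unitE. Qed.

Lemma ord_regular f : f 0%N != 0 -> f \isn't a GRing.unit -> (0 < ord (f 0%N))%N.
Proof.
move=> f0; apply: contraNltn; rewrite leqn0 => /eqP o.
by rewrite fps2_unitE; have := coef_ord f0; rewrite o.
Qed.

(** Some member of the pencil is not divisible by f, so the determinants of
   the pencil do not vanish identically; at a member where the determinant
   has its generic order, f does not divide either. *)
Lemma polar_coprime_regular f (w : oneform R) : f 0%N != 0 -> rirreducible f ->
  ~ (rdvd f w.1 /\ rdvd f w.2) -> exists n, polar_coprime w f n.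
Proof.
move=> f_reg irr ndvd; have [_ nu _] := irr.
have d0 := ord_regular f_reg nu.
have [t0 nz] : exists t0, \det (mulmat f_reg (w.1 + cseriesC t0 * w.2)) != 0.
  (* t0 = 0 if f does not divide P, and t0 = 1 otherwise *)
  have [f1|f1] := pselect (rdvd f w.1); last first.
    exists 0; apply: det_mulmat_neq0; apply: rirreducible_coprime => //.
    by rewrite rmorph0 mul0r addr0.
  exists 1; apply: det_mulmat_neq0; apply: rirreducible_coprime => //.
  rewrite rmorph1 mul1r => f12; apply: ndvd; split=> //.
  by rewrite -[w.2](addKr w.1) addrC; apply: rdvdB.
have [n [rs rsP]] := pencil_order nz; exists n.
apply: (@generic_P1_line _ rs) => a t a0 /rsP[low dn].
have -> : polar w a (a * t) = cseriesC a * (w.1 + cseriesC t * w.2).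
  by rewrite /polar rmorphM mulrDr mulrA.
split; last by apply: int_number_unit; [exact: cseriesC_unit | exact: int_number_mulmat].
apply/rcoprimeC/rirreducible_coprime => // fu; case/negP: dn.
have fu' : rdvd f (w.1 + cseriesC t * w.2).
  rewrite -[X in rdvd f X](mulKr (cseriesC_unit a0)).
  exact: rdvd_mull.
by rewrite det_mulmat_dvd.
Qed.

(** If f(0, y) = 0, then x divides f, so that f is x up to a unit. *)
Lemma rirreducible_regular f : rirreducible f -> f 0%N != 0 \/ swap f 0%N != 0.
Proof.
move=> [_ _ irr]; have [f0|] := eqVneq (f 0%N) 0; [right|by left].
have fE : f = fpsX _ * FPS (fun n => f (n + 1)%N).
  by rewrite -[X in X * _]expr1; apply: fps_cutE => -[].
have [|] := irr _ _ fE; rewrite fps2_unitE ?eqxx //= => f10.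
by apply: contraNneq f10 => /fpsP/(_ 1%N) /= ->.
Qed.

Lemma polar_coprime_irreducible f (w : oneform R) : rirreducible f ->
  ~ (rdvd f w.1 /\ rdvd f w.2) -> exists n, polar_coprime w f n.
Proof.
move=> irr ndvd; have [f0|f0] := rirreducible_regular irr.
  exact: polar_coprime_regular.
have [||n nP] := @polar_coprime_regular (swap f) (swap w.1, swap w.2) f0.
- exact: rirreducible_swap.
- by rewrite /= !rdvd_swap.
exists n; apply: generic_P1_mono nP => a b.
rewrite polar_swap -surjective_pairing.
by move=> [/rcoprime_swap cop /int_number_swap].
Qed.

Lemma int_number_exists_irreducible f g : rirreducible f -> rcoprime f g ->
  exists n, int_number g f n.
Proof.
move=> irr cop; wlog f0 : f g irr cop / f 0%N != 0.
  move=> H; have [/H|f0] := rirreducible_regular irr; first exact.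
  have [||n nP] := H (swap f) (swap g) _ _ f0; first exact: rirreducible_swap.
    exact/rcoprime_swap.
  by exists n; apply: int_number_swap.
have [n [dn low]] := fps_orderP (det_mulmat_neq0 f0 cop).
by exists n; apply: int_number_mulmat dn.
Qed.

End Pencils.

(** * Polars and the GSV-index *)

Section GSV.
Variable R : realType.
Implicit Types (f g h : cseries R) (w : oneform R).

Lemma pdxE f : pdx f = fps_deriv f.
Proof.
by apply/fpsP => i; apply/fpsP => j; rewrite coef_fpsMn.
Qed.

Lemma pdyE f : pdy f = swap (pdx (swap f)). Proof. by []. Qed.

Lemma pdxM f g : pdx (f * g) = pdx f * g + f * pdx g.
Proof. by rewrite !pdxE fps_derivM. Qed.

Lemma pdyM f g : pdy (f * g) = pdy f * g + f * pdy g.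
Proof. by rewrite !pdyE swapM pdxM swapD !swapM !swapK. Qed.

(** One of the partial derivatives has, lexicographically, a smaller order
   than f: the first one if x divides f, the second one otherwise. *)
Lemma not_rdvd_partials f : f != 0 -> f \isn't a GRing.unit ->
  ~ (rdvd f (pdx f) /\ rdvd f (pdy f)).
Proof.
move=> f0 nu [[p ep] [q eq]].
have [f00|f00] := eqVneq (ord f) 0%N.
  have r0 : f 0%N != 0 by rewrite -f00; apply: coef_ord.
  have d0 := ord_regular r0 nu.
  have nz : pdy f 0%N (ord (f 0%N)).-1 != 0.
    by rewrite /= prednK // mulrn_eq0 negb_or -lt0n d0 coef_ord.
  have e0 : pdy f 0%N = q 0%N * f 0%N.
    by rewrite eq; apply: (rmorphM (@fps_ev0 _)).
  have q0 : q 0%N != 0.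
    by apply: contraNneq nz => q0; rewrite e0 q0 mul0r.
  have := ord_le nz; rewrite e0 ordM // => le.
  have := leq_trans (leq_addl _ _) le.
  by rewrite -ltnS prednK // ltnn.
rewrite -lt0n in f00.
have nz : pdx f (ord f).-1 != 0.
  rewrite pdxE /= prednK //; have [j fj] := fps_neq0P (coef_ord f0).
  apply/eqP => /fpsP/(_ j); rewrite coef_fpsMn => /eqP.
  by rewrite mulrn_eq0 (negPf fj) orbF; apply/negP; rewrite -lt0n.
have p0 : p != 0.
  by apply: contraNneq nz => p0; rewrite ep p0 mul0r.
have := ord_le nz; rewrite ep ordM // => le.
have := leq_trans (leq_addl _ _) le.
by rewrite -ltnS prednK // ltnn.
Qed.

Lemma singular_foliation_ndvd w f : singular_foliation w ->
  rirreducible f -> ~ (rdvd f w.1 /\ rdvd f w.2).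
Proof. by move=> [cop _ _] [_ /negP nu _] [f1 f2]; apply/nu/cop. Qed.

Lemma wedge_dformM w f g :
  wedge w (dform (f * g)) = f * wedge w (dform g) + g * wedge w (dform f).
Proof. by case: w => p q; rewrite /wedge /dform /= pdxM pdyM; ring. Qed.

(** Modulo f, the wedge product of w with d(f g) is g times that with df. *)
Lemma invariant_curve_factor w f g : rcoprime f g ->
  invariant_curve w (f * g) -> invariant_curve w f.
Proof.
move=> cop [k e]; suff [c ec] : rdvd f (wedge w (dform f)).
  by exists c; rewrite ec mulrC.
apply: (rdvd_coprime_mul cop); exists (g * k - wedge w (dform g)).
have -> : g * wedge w (dform f) = wedge w (dform (f * g)) - f * wedge w (dform g).
  by rewrite wedge_dformM addrAC subrr add0r.
by rewrite e mulrBl (mulrC f (wedge _ _)) -mulrA (mulrC f).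
Qed.

(** From P f_y - Q f_x = f k: f_y w = Q df + f k dx and f_x w = P df - f k dy.
   The first one is used when f does not divide f_y; then f does not divide Q
   either, for otherwise it would divide P f_y, hence P. *)
Lemma gsv_decomp_exists w f : singular_foliation w -> rirreducible f ->
  invariant_curve w f ->
  exists g h eta, [/\ rcoprime g f, rcoprime h f & gsv_decomp w f g h eta].
Proof.
move=> sing irr [k ek]; have [f0 nu _] := irr.
have ndvd := singular_foliation_ndvd sing irr.
rewrite /wedge /dform /= in ek.
have [fy|fy] := pselect (rdvd f (pdy f)).
  have fx : ~ rdvd f (pdx f) by move=> fx; case: (not_rdvd_partials f0 nu).
  have cx := rirreducible_coprime irr fx.
  have f1 : ~ rdvd f w.1.
    move=> f1; apply: ndvd; split=> //; apply: (rdvd_coprime_mul cx).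
    rewrite mulrC -[_ * _](subKr (w.1 * pdy f)) ek.
    by apply: rdvdB; [apply: rdvd_mull | apply/rdvd_mulr/rdvd_refl].
  exists (pdx f), w.1, (0, - k); split=> //.
  - exact: rcoprimeC.
  - exact/rcoprimeC/rirreducible_coprime.
  - split=> /=; first by rewrite mulr0 addr0 mulrC.
    by rewrite mulrN -ek opprB addrC subrK mulrC.
have cy := rirreducible_coprime irr fy.
have f2 : ~ rdvd f w.2.
  move=> f2; apply: ndvd; split=> //; apply: (rdvd_coprime_mul cy).
  rewrite mulrC -[_ * _](subrK (w.2 * pdx f)) ek.
  by apply: rdvdD; [apply/rdvd_mulr/rdvd_refl | apply: rdvd_mulr].
exists (pdy f), w.2, (k, 0); split.
- exact: rcoprimeC.
- exact/rcoprimeC/rirreducible_coprime.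
- split=> /=; last by rewrite mulr0 addr0 mulrC.
  by rewrite -ek addrC subrK mulrC.
Qed.

Lemma polar_coprimeM w f g m n :
  polar_coprime w f m -> polar_coprime w g n -> polar_coprime w (f * g) (m + n).
Proof.
move=> Pf Pg; apply: generic_P1_mono (generic_P1_and Pf Pg) => a b.
move=> [[cf If] [cg Ig]]; split; first exact: rcoprime_mul.
by apply/int_numberC/int_numberM => //; apply: int_numberC.
Qed.

Lemma polar_dformM f g a b : polar (dform (f * g)) a b =
  g * polar (dform f) a b + polar (dform g) a b * f.
Proof. by rewrite /polar /dform /= pdxM pdyM; ring. Qed.

(** Modulo f, the polar of d(f g) is g times the polar of df. *)
Lemma polar_coprime_dform_add f g m k : rcoprime f g ->
  int_number f g k -> polar_coprime (dform f) f m ->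
  polar_coprime (dform (f * g)) f (k + m).
Proof.
move=> cop Ifg; apply: generic_P1_mono => a b [cf If].
rewrite polar_dformM; split.
  move=> d du df; apply: (rcoprime_mul cop (rcoprimeC cf)) => //.
  by rewrite -[_ * _](addrK (polar (dform g) a b * f)); apply/rdvdB/rdvd_mull.
by apply/int_number_mod/int_numberM => //; apply: int_numberC.
Qed.

Lemma polar_coprime_dformM f g m n k : rcoprime f g ->
    int_number f g k -> polar_coprime (dform f) f m ->
    polar_coprime (dform g) g n ->
  polar_coprime (dform (f * g)) (f * g) (k + m + (k + n)).
Proof.
move=> cop Ifg Pf Pg; apply: polar_coprimeM; first exact: polar_coprime_dform_add.
rewrite mulrC; apply: polar_coprime_dform_add => //; first exact: rcoprimeC.
exact: int_numberC.
Qed.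

Lemma gsv_decomp_polar w f g h eta a b : gsv_decomp w f g h eta ->
  g * polar w a b = h * polar (dform f) a b + polar eta a b * f.
Proof.
case: w eta => p q [r s] [/= e1 e2]; rewrite /polar /=.
rewrite mulrDr (mulrCA g _ p) (mulrCA g _ q) e1 e2; ring.
Qed.

(** By induction on the way in which z is computed. The intersection numbers
   on the right depend on f alone, so this also shows that the index does not
   depend on the splitting nor on the decompositions chosen. *)
Lemma is_GSV_polar w f z : singular_foliation w -> is_GSV w f z ->
  exists n m : nat, [/\ polar_coprime w f n, polar_coprime (dform f) f m &
    z = n%:Z - m%:Z].
Proof.
move=> sing; elim=> {f z} [f g h eta m n irr inv cg ch dec Im In|].
  have [N PN] := polar_coprime_irreducible irr (singular_foliation_ndvd sing irr).
  have [f0 nu _] := irr.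
  have [M PM] := @polar_coprime_irreducible _ f (dform f) irr
    (not_rdvd_partials f0 nu).
  exists N, M; split=> //.
  have [a [b [[_ IN] [_ IM]]]] := generic_P1_ex (generic_P1_and PN PM).
  have J1 := int_numberM (rcoprimeC cg) (int_numberC In) IN.
  have J2 := int_numberM (rcoprimeC ch) (int_numberC Im) IM.
  rewrite (gsv_decomp_polar a b dec) in J1.
  have := int_number_uniq J1 (int_number_mod _ J2).
  move=> /(congr1 Posz); rewrite !PoszD => E.
  by apply/eqP; rewrite subr_eq addrAC eq_sym subr_eq addrC E addrC.
move=> f g z1 z2 k inv1 inv2 cop _ [N1 [M1 [PN1 PM1 ->]]] _ [N2 [M2 [PN2 PM2 ->]]] I.
exists (N1 + N2)%N, (k + M1 + (k + M2))%N; split.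
- exact: polar_coprimeM.
- exact: polar_coprime_dformM.
- by lia.
Qed.

(** The finiteness of the intersection numbers of f with the series coprime to
   f is carried along, as the adjunction step needs i(f, g). *)
Lemma is_GSV_exists w f : singular_foliation w -> reduced_curve f ->
  invariant_curve w f -> exists z, is_GSV w f z.
Proof.
move=> sing [f00 sf].
have nu : f \isn't a GRing.unit by rewrite fps2_unitE f00 eqxx.
suff [] : (forall u, rcoprime f u -> exists n, int_number u f n) /\
    (invariant_curve w f -> exists z, is_GSV w f z) by [].
move: {f00} f sf nu; apply: squarefree_ind => f.
  move=> irr; split=> [u|inv]; first exact: int_number_exists_irreducible.
  have [g [h [eta [cg ch dec]]]] := gsv_decomp_exists sing irr inv.
  have [n In] := int_number_exists_irreducible irr (rcoprimeC cg).
  have [m Im] := int_number_exists_irreducible irr (rcoprimeC ch).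
  exists (m%:Z - n%:Z).
  by apply: (GSV_irreducible irr inv cg ch dec); apply: int_numberC.
move=> g cop [finf Gf] [fing Gg]; split=> [u cu|inv].
  have [n In] : exists n, int_number u f n.
    by apply: finf => d df; apply: cu; apply: rdvd_mulr.
  have cgu : rcoprime g u by move=> d dg; apply: cu; apply: rdvd_mull.
  have [m Im] := fing u cgu.
  exists (n + m)%N; apply/int_numberC/int_numberM; try exact: int_numberC.
  by move=> d du df; apply: (cu) du; apply: rdvd_mulr.
have [z1 G1] := Gf (invariant_curve_factor cop inv).
have inv' : invariant_curve w (g * f) by rewrite mulrC.
have [z2 G2] := Gg (invariant_curve_factor (rcoprimeC cop) inv').
have [n In] := finf g cop.
exists (z1 + z2 - 2 * n%:Z); apply: GSV_adjunction G1 G2 (int_numberC In) => //.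
  exact: invariant_curve_factor inv.
exact: invariant_curve_factor (rcoprimeC cop) inv'.
Qed.

Lemma polar_int_number_uniq w f m n :
  polar_int_number w f m -> polar_int_number w f n -> m = n.
Proof.
move=> Pm Pn; have [a [b [Im In]]] := generic_P1_ex (generic_P1_and Pm Pn).
exact: int_number_uniq Im In.
Qed.

End GSV.

Theorem proposition5p4 (R : realType) (w : oneform R) (f : cseries R)
    (hw : singular_foliation w) (hred : reduced_curve f)
    (hinv : invariant_curve w f) :
  exists N M : nat,
    [/\ polar_int_number w f N,
        polar_int_number (dform f) f M &
        forall z : int, is_GSV w f z <-> z = N%:Z - M%:Z].
Proof.
have [z0 G0] := is_GSV_exists hw hred hinv.
have [N [M [/polar_coprime_int PN /polar_coprime_int PM e0]]] :=
  is_GSV_polar hw G0.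
exists N, M; split=> // z; split=> [G|->]; last by rewrite -e0.
have [N' [M' [/polar_coprime_int PN' /polar_coprime_int PM' ->]]] :=
  is_GSV_polar hw G.
by rewrite (polar_int_number_uniq PN PN') (polar_int_number_uniq PM PM').
Qed.
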